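(* Let $\mathcal{A}$ and $\mathcal{B}$ be two unital complex $\ast$-algebras with multiplicative identities $1_{\mathcal{A}}$ and $1_{\mathcal{B}}$, respectively, such that $\mathcal{A}$ is prime and has a nontrivial projection. Let $\eta,\nu$ be nonzero complex numbers and let $\Phi:\mathcal{A}\rightarrow\mathcal{B}$ be a bijective mapping (not assumed additive or linear). Suppose that one of the following two hypotheses holds: (A) $\overline{\eta}\neq -1$, $\nu\neq -1$, and $\Phi$ preserves the triple product $a\blacksquare_{\eta}b\blacksquare_{\nu}c$, i.e. $\Phi((a\blacksquare_{\eta}b)\blacksquare_{\nu}c)=(\Phi(a)\blacksquare_{\eta}\Phi(b))\blacksquare_{\nu}\Phi(c)$ for all $a,b,c\in\mathcal{A}$; (B) $\eta\neq -1$, $\nu\neq -1$, and $\Phi$ preserves the mixed product $a\blacksquare_{\eta}b\circ_{\nu}c$, i.e. $\Phi((a\blacksquare_{\eta}b)\circ_{\nu}c)=(\Phi(a)\blacksquare_{\eta}\Phi(b))\circ_{\nu}\Phi(c)$ for all $a,b,c\in\mathcal{A}$. Then $\Phi$ is additive. Moreover: (i) if $\Phi(1_{\mathcal{A}})$ is a projection of $\mathcal{B}$, then $\Phi$ is a $\ast$-Jordan ring isomorphism; (ii) if $\mathcal{B}$ is prime and $\Phi(1_{\mathcal{A}})$ is a projection of $\mathcal{B}$, then $\Phi$ is either a $\ast$-ring isomorphism or a $\ast$-ring anti-isomorphism.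
   Context: A complex $\ast$-algebra is an associative complex algebra with a conjugate-linear involution $\ast$ satisfying $(ab)^*=b^*a^*$. For elements $a,b$ of a complex $\ast$-algebra and a nonzero complex number $\eta$ (resp. $\nu$), $a\blacksquare_{\eta}b=a^{*}b+\eta ba^{*}$ and $a\circ_{\nu}b=ab+\nu ba$. A projection is an element $p$ with $p=p^*=p^2$; it is nontrivial if $p\neq 0$ and $p\neq 1$. An algebra is prime if $a\mathcal{A}b=\{0\}$ implies $a=0$ or $b=0$. A $\ast$-Jordan ring isomorphism is an additive bijection $\Phi$ with $\Phi(ac+ca)=\Phi(a)\Phi(c)+\Phi(c)\Phi(a)$ and $\Phi(a^* )=\Phi(a)^*$ for all $a,c$. A $\ast$-ring isomorphism (resp. $\ast$-ring anti-isomorphism) is an additive bijection $\Phi$ with $\Phi(a^* )=\Phi(a)^*$ and $\Phi(ac)=\Phi(a)\Phi(c)$ (resp. $\Phi(ac)=\Phi(c)\Phi(a)$) for all $a,c$; complex linearity is not required. *)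

(* Defs.v *)
From HB Require Import structures.
From mathcomp Require Import all_boot all_order all_algebra.
From mathcomp Require Import reals complex.
Import GRing.Theory Num.Theory.

Set Implicit Arguments.
Unset Strict Implicit.
Unset Printing Implicit Defensive.

Local Open Scope ring_scope.

(* [algType] is unital, associative and has 1 != 0. *)
HB.mixin Record hasStar (R : realType) A of GRing.Algebra R[i] A := {
  star : A -> A;
  starD : forall a b : A, star (a + b) = star a + star b;
  starZ : forall (c : R[i]) (a : A), star (c *: a) = Num.conj c *: star a;
  starM : forall a b : A, star (a * b) = star b * star a;
  starK : forall a : A, star (star a) = a
}.

#[short(type="starAlgType")]
HB.structure Definition StarAlgebra (R : realType) :=
  {A of GRing.Algebra R[i] A & hasStar R A}.

Definition bsquare (R : realType) (A : starAlgType R) (eta : R[i]) (a b : A) : A :=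
  star a * b + eta *: (b * star a).

Definition circ (R : realType) (A : starAlgType R) (nu : R[i]) (a b : A) : A :=
  a * b + nu *: (b * a).

Definition is_projection (R : realType) (A : starAlgType R) (p : A) : Prop :=
  p = star p /\ p = p * p.

Definition nontrivial_projection (R : realType) (A : starAlgType R) (p : A) : Prop :=
  [/\ is_projection p, p <> 0 & p <> 1].

Definition prime_algebra (R : realType) (A : starAlgType R) : Prop :=
  forall a b : A, (forall x : A, a * x * b = 0) -> a = 0 \/ b = 0.

Definition additive_map (R : realType) (A B : starAlgType R) (Phi : A -> B) : Prop :=
  {morph Phi : a c / a + c}.

Definition preserves_star (R : realType) (A B : starAlgType R) (Phi : A -> B) : Prop :=
  {morph Phi : a / star a}.

Definition star_jordan_ring_iso (R : realType) (A B : starAlgType R)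
    (Phi : A -> B) : Prop :=
  [/\ bijective Phi, additive_map Phi,
      forall a c : A, Phi (a * c + c * a) = Phi a * Phi c + Phi c * Phi a
    & preserves_star Phi].

Definition star_ring_iso (R : realType) (A B : starAlgType R)
    (Phi : A -> B) : Prop :=
  [/\ bijective Phi, additive_map Phi, preserves_star Phi
    & forall a c : A, Phi (a * c) = Phi a * Phi c].

Definition star_ring_anti_iso (R : realType) (A B : starAlgType R)
    (Phi : A -> B) : Prop :=
  [/\ bijective Phi, additive_map Phi, preserves_star Phi
    & forall a c : A, Phi (a * c) = Phi c * Phi a].

Definition preserves_triple (R : realType) (A B : starAlgType R)
    (eta nu : R[i]) (Phi : A -> B) : Prop :=
  forall a b c : A,
    Phi (bsquare nu (bsquare eta a b) c)
    = bsquare nu (bsquare eta (Phi a) (Phi b)) (Phi c).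

Definition preserves_mixed (R : realType) (A B : starAlgType R)
    (eta nu : R[i]) (Phi : A -> B) : Prop :=
  forall a b c : A,
    Phi (circ nu (bsquare eta a b) c)
    = circ nu (bsquare eta (Phi a) (Phi b)) (Phi c).

(* Main.v *)
Require Import Defs.
From mathcomp Require Import boolp.
From mathcomp Require Import all_boot all_order all_algebra.
From mathcomp Require Import reals complex.
Import GRing.Theory Num.Theory.

Local Open Scope ring_scope.

(** The two hypotheses are one: since [star (bsquare eta b a)] is
[bsquare (Num.conj eta) a b], a map preserving the triple product for [eta]
preserves the mixed product for the conjugate of [eta].

Additivity.  Putting [a = 1] in the mixed product turns it into the product
[t * c + nu *: (c * t)], up to the invertible scalar [1 + eta].  The image side
is additive in the slot of [Phi t], so the relation
[Phi t = Phi x + Phi y] (written [sum_of t x y]) is stable under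
[t |-> t * c + nu *: (c * t)] applied to its three terms.  Given [x] and [y], surjectivity yields some [t] with [sum_of t x y], and
one must show [t = x + y].  Let [e] be the given projection and [f = 1 - e].
Products with [e] or [f] make one of the last two terms vanish, and injectivity
then computes three Peirce components of [t].  The fourth, a diagonal one, is
reached through products with [e * c * f], because primeness of [A] turns
[e * s * e * c * f = 0] for all [c] into [e * s * e = 0].  This successively shows that [Phi] is additive on a diagonal corner plus the
off-diagonal part, on the off-diagonal part (where the sum is obtained as part
of a product, [sum_of_off_off]), on each diagonal corner, and on the full Peirce
decomposition; [sum_ofD] assembles these facts.

Jordan isomorphism.  If [q = Phi 1] is a projection, the map
[b |-> circ nu (bsquare eta 1 b) 1] is multiplication by a nonzero scalar on
[A], while [b |-> circ nu (bsquare eta q b) q] kills [1 - q]; so [q = 1].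
Inserting units in the three slots then gives that [Phi] commutes with the
scalar [(1 + nu) * (1 + eta)], with [star], and with [a * c + c * a].

Dichotomy.  This is Herstein's theorem on Jordan isomorphisms onto a prime
ring [B].  The defects [D = Phi (a * b) - Phi a * Phi b] and
[E = Phi (a * b) - Phi b * Phi a] satisfy [D * x * E + E * x * D = 0] for all
[x], so one of them vanishes by primeness; as a group is not the union of two
proper subgroups, the same alternative holds for all [a] and [b] at once. *)

(** Primeness does not involve the star or the scalars; on a star algebra this is
[prime_algebra]. *)
Definition prime_ring (A : nzRingType) : Prop :=
  forall a b : A, (forall x : A, a * x * b = 0) -> a = 0 \/ b = 0.

Definition complementary {A : nzRingType} (e f : A) : Prop :=
  [/\ e + f = 1, e * f = 0 & f * e = 0].

(** * Additivity of maps compatible with the product t c + nu c t *)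

Section Additivity.
Set Implicit Arguments. Unset Strict Implicit.

Variables (K : fieldType) (A : algType K) (B : zmodType) (nu : K) (Phi : A -> B).

Definition sum_of (t x y : A) : Prop := Phi t = Phi x + Phi y.

Lemma complementary_sym (e f : A) : complementary e f -> complementary f e.
Proof. by case=> ef1 ef fe; split=> //; rewrite addrC. Qed.

Lemma complementary_idem (e f : A) : complementary e f -> e * e = e.
Proof. by case=> ef1 ef _; rewrite -[RHS]mulr1 -ef1 mulrDr ef addr0. Qed.

Lemma peirce (e f x : A) : complementary e f ->
  x = e * x * e + (e * x * f + f * x * e) + f * x * f.
Proof.
case=> ef1 _ _; rewrite addrA -mulrDr -addrA -mulrDr ef1 !mulr1.
by rewrite -mulrDl ef1 mul1r.
Qed.

Hypotheses (nu_neq0 : nu != 0) (nu1_neq0 : 1 + nu != 0) (primeA : prime_ring A).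
Hypothesis Phi_bij : bijective Phi.
Hypothesis sum_of_circ : forall t x y c, sum_of t x y ->
  sum_of (t * c + nu *: (c * t)) (x * c + nu *: (c * x)) (y * c + nu *: (c * y)).

Lemma sum_of_ex (x y : A) : exists t, sum_of t x y.
Proof.
by case: Phi_bij => g _ gK; exists (g (Phi x + Phi y)); rewrite /sum_of gK.
Qed.

Lemma sum_of_uniq (t t' x y : A) : sum_of t x y -> sum_of t' x y -> t = t'.
Proof. by rewrite /sum_of => <- /(bij_inj Phi_bij). Qed.

(** The preimage [z] of [0] satisfies [sum_of z z z]; multiplying by [0] gives
[sum_of 0 0 0]. *)
Lemma Phi0 : Phi 0 = 0.
Proof.
case: Phi_bij => g _ gK.
have h : sum_of (g 0) (g 0) (g 0) by rewrite /sum_of gK addr0.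
have := sum_of_circ 0 h; rewrite mulr0 mul0r scaler0 addr0 /sum_of.
by move/(congr1 (fun z => z - Phi 0)); rewrite subrr addrK.
Qed.

Lemma sum_of0l (t y : A) : sum_of t 0 y -> t = y.
Proof. by rewrite /sum_of Phi0 add0r => /(bij_inj Phi_bij). Qed.

Lemma sum_of0r (t x : A) : sum_of t x 0 -> t = x.
Proof. by rewrite /sum_of Phi0 addr0 => /(bij_inj Phi_bij). Qed.

Lemma addr_scale_inj (u v : A) : u + nu *: u = v + nu *: v -> u = v.
Proof.
by rewrite -{1}[u]scale1r -{1}[v]scale1r -!scalerDl => /(scalerI nu1_neq0).
Qed.

Section Corners.
Variables e f : A.
Hypothesis ef : complementary e f.

Let ef0 : e * f = 0. Proof. by case: ef. Qed.
Let fe0 : f * e = 0. Proof. by case: ef. Qed.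
Let ee : e * e = e. Proof. exact: complementary_idem ef. Qed.
Let ff : f * f = f. Proof. exact: complementary_idem (complementary_sym ef). Qed.
Let xee x : x * e * e = x * e. Proof. by rewrite -mulrA ee. Qed.
Let xff x : x * f * f = x * f. Proof. by rewrite -mulrA ff. Qed.
Let xef x : x * e * f = 0. Proof. by rewrite -mulrA ef0 mulr0. Qed.
Let xfe x : x * f * e = 0. Proof. by rewrite -mulrA fe0 mulr0. Qed.

(** Normalizes to sums of scaled, left-associated words in which [e] and [f]
are never adjacent. *)
Definition corner_simp := (mulrDl, mulrDr, =^~ scalerAl, =^~ scalerAr, mulrA,
  ef0, fe0, ee, ff, xee, xff, xef, xfe, mul0r, mulr0, scaler0, addr0, add0r).

(** The off-diagonal projection is the composite of the products with [e] and
with [nu^-1 *: f]: the first scales the two off-diagonal components by [nu] and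
[1], the second by [nu^-1] and [1], and each kills one diagonal component. *)
Lemma sum_of_off (t x y : A) : sum_of t x y ->
  sum_of (e * t * f + f * t * e) (e * x * f + f * x * e) (e * y * f + f * y * e).
Proof.
move/(sum_of_circ e)/(sum_of_circ (nu^-1 *: f)).
by rewrite !corner_simp -!scalerDr !scalerA mulfV // !scale1r.
Qed.

(** The product with [f] scales the components other than [e * s * e] by [1],
[nu] and [1 + nu], all invertible. *)
Lemma circ_corner_inj (s t : A) :
  s * f + nu *: (f * s) = t * f + nu *: (f * t) ->
  [/\ e * s * f = e * t * f, f * s * e = f * t * e & f * s * f = f * t * f].
Proof.
move=> h; have cmp u v := congr1 (fun z => u * z * v) h; split.
- by have := cmp e f; rewrite !corner_simp.
- by have := cmp f e; rewrite !corner_simp => /(scalerI nu_neq0).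
- by have := cmp f f; rewrite !corner_simp => /addr_scale_inj.
Qed.

Lemma corner_faithful (s t : A) : f <> 0 ->
  (forall c, e * s * e * c * f = e * t * e * c * f) -> e * s * e = e * t * e.
Proof.
move=> f0 h; case: (primeA (a := e * s * e - e * t * e) (b := f)) => [c||//].
  by rewrite !mulrBl h subrr.
by move/subr0_eq.
Qed.

(** The product with [f] kills the diagonal term, which settles every component
of [t] but [e * t * e].  For the latter, the product with [e * c * f] sends the
off-diagonal term to diagonal ones, and [sum_of_off] discards these. *)
Lemma sum_of_diag_off (a b : A) : f <> 0 ->
  sum_of (e * a * e + (e * b * f + f * b * e)) (e * a * e) (e * b * f + f * b * e).
Proof.
move=> f0; have [t ht] := sum_of_ex (e * a * e) (e * b * f + f * b * e).
suff <- : t = e * a * e + (e * b * f + f * b * e) by [].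
have [tef tfe tff] :
    [/\ e * t * f = e * b * f, f * t * e = f * b * e & f * t * f = 0].
  have := sum_of_circ f ht; rewrite [X in sum_of _ X _](_ : _ = 0); last first.
    by rewrite !corner_simp.
  by move/sum_of0l/circ_corner_inj; rewrite !corner_simp.
have tee : e * t * e = e * a * e.
  apply: corner_faithful f0 _ => c.
  have := sum_of_off (sum_of_circ (e * c * f) ht).
  rewrite [X in sum_of _ _ X](_ : _ = 0); last by rewrite !corner_simp.
  move/sum_of0r; rewrite !corner_simp => h.
  have xftf z : z * f * t * f = 0 by rewrite -2!mulrA (mulrA f) tff mulr0.
  by rewrite xftf scaler0 addr0 in h.
by rewrite {1}(peirce t ef) tee tef tfe tff addr0.
Qed.

End Corners.

Section OppositeCorners.
Variables e f : A.
Hypotheses (ef : complementary e f) (e0 : e <> 0) (f0 : f <> 0).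
Let simp := corner_simp ef.

(** For off-diagonal [u] and [v], the off-diagonal part of the product of
[f + v] with [e + u] is a combination of the components of [u] and [v] with
coefficients [1] and [nu], since [u * v] and [v * u] are diagonal.  The relation
[sum_of (f + v) f v] is known, and multiplying it by [e + u] turns [f] into the
contribution of [u] and [v] into its own. *)
Lemma sum_of_off_off (x y : A) :
  sum_of ((e * x * f + f * x * e) + (e * y * f + f * y * e))
    (e * x * f + f * x * e) (e * y * f + f * y * e).
Proof.
(* The factor nu^-1 makes up for the coefficient nu on the (e, f) components. *)
have := sum_of_circ (e + (nu^-1 *: (e * x * f) + f * x * e))
  (sum_of_diag_off (complementary_sym ef) 1
     (nu^-1 *: (e * y * f) + f * y * e) e0).
move/(sum_of_off (complementary_sym ef)).
rewrite !(simp, mulr1, scalerDr, scalerA) mulfV // !scale1r.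
rewrite [X in sum_of X](_ : _ =
  (e * x * f + f * x * e) + (e * y * f + f * y * e)).
  by rewrite [f * x * e + _]addrC [f * y * e + _]addrC.
by rewrite addrC [f * y * e + _]addrC addrACA.
Qed.

(** The product with [e * c * f] moves the corner [e * A * e] to the
off-diagonal part, where additivity is known. *)
Lemma sum_of_diag_diag (a b : A) :
  sum_of (e * a * e + e * b * e) (e * a * e) (e * b * e).
Proof.
have [t ht] := sum_of_ex (e * a * e) (e * b * e).
suff <- : t = e * a * e + e * b * e by [].
have [tef tfe tff] : [/\ e * t * f = 0, f * t * e = 0 & f * t * f = 0].
  have := sum_of_circ f ht; rewrite [X in sum_of _ X _](_ : _ = 0); last first.
    by rewrite !simp.
  move/sum_of0l; rewrite [RHS](_ : _ = 0 * f + nu *: (f * 0)); last first.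
    by rewrite !simp.
  by move/(circ_corner_inj ef); rewrite !simp.
have tE : t = e * t * e by rewrite {1}(peirce t ef) tef tfe tff !addr0.
have tee : e * t * e = e * (a + b) * e.
  apply: (corner_faithful f0) => c.
  have := sum_of_circ (e * c * f) ht; rewrite tE !simp => h.
  have := sum_of_off_off (a * e * c * f) (b * e * c * f); rewrite !simp.
  by move/(sum_of_uniq h).
by rewrite {1}tE tee !simp.
Qed.

End OppositeCorners.

(** The product with [e] kills the last term and determines all components of
[t] but [f * t * f].  The product with [f] kills [e * x * e] instead, and what
is left is an instance of [sum_of_diag_off] for the pair [(f, e)]. *)
Lemma sum_of_off_diag (e f x : A) : complementary e f -> e <> 0 -> f <> 0 ->
  sum_of x (e * x * e + (e * x * f + f * x * e)) (f * x * f).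
Proof.
move=> ef e0 f0; pose simp := corner_simp ef.
have [t ht] := sum_of_ex (e * x * e + (e * x * f + f * x * e)) (f * x * f).
suff tx : t = x by rewrite -{1}tx.
have [tfe tef tee] : [/\ f * t * e = f * x * e, e * t * f = e * x * f
    & e * t * e = e * x * e].
  have := sum_of_circ e ht; rewrite [X in sum_of _ _ X](_ : _ = 0); last first.
    by rewrite !simp.
  by move/sum_of0r/(circ_corner_inj (complementary_sym ef)); rewrite !simp.
have tff : f * t * f = f * x * f.
  have h := sum_of_circ f ht.
  have := sum_of_diag_off (complementary_sym ef) ((1 + nu) *: x)
    (e * x * f + nu *: (f * x * e)) e0.
  move: h; rewrite !simp scalerDl scale1r [nu *: _ + e * x * f]addrC.
  rewrite /sum_of [in Phi _ + Phi (f * x * f + _)]addrC => /sum_of_uniq h /h.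
  by move/(congr1 (fun z => f * z * f)); rewrite !simp => /addr_scale_inj.
by rewrite (peirce t ef) tef tfe tee tff -(peirce x ef).
Qed.

Lemma sum_ofD (e f x y : A) : complementary e f -> e <> 0 -> f <> 0 ->
  sum_of (x + y) x y.
Proof.
move=> ef e0 f0; have fe := complementary_sym ef.
have PhiE z :
    Phi z = Phi (e * z * e) + Phi (e * z * f + f * z * e) + Phi (f * z * f).
  by rewrite [LHS](sum_of_off_diag z ef e0 f0) (sum_of_diag_off ef z z f0).
have De := sum_of_diag_diag ef e0 f0 x y.
have Df := sum_of_diag_diag fe f0 e0 x y.
rewrite /sum_of (PhiE (x + y)) (PhiE x) (PhiE y) !(mulrDl, mulrDr) De Df.
rewrite (addrACA (e * x * f)) (sum_of_off_off ef e0).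
by rewrite [RHS]addrACA [in RHS](addrACA (Phi (e * x * e))).
Qed.

End Additivity.

(** * Jordan isomorphisms onto a prime ring *)

Section Herstein.
Set Implicit Arguments. Unset Strict Implicit.

(** Moving [a] and [b] past each other in [a * x * b * y * a] in two ways gives
[b * x * a * y * a] with opposite signs. *)
Lemma prime_symmetric_annihilator (B : nzRingType) (a b : B) :
  prime_ring B -> (forall x : B, x + x = 0 -> x = 0) ->
  (forall x, a * x * b + b * x * a = 0) -> a = 0 \/ b = 0.
Proof.
move=> primeB tf h.
have hN x : a * x * b = - (b * x * a) by apply/eqP; rewrite -addr_eq0 h.
have bab0 x y : b * x * a * y * a = 0.
  apply: tf; rewrite -{1}[b * x * a]opprK -hN mulNr mulNr.
  have -> : a * x * b * y * a = - (a * (x * a * y) * b).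
    by rewrite -2!mulrA (mulrA b) -[b * y * a]opprK -hN mulrN !mulrA.
  by rewrite opprK hN !mulrA addNr.
have [a0|a0] := pselect (a = 0); [by left|right].
have ba0 x : b * x * a = 0 by case: (primeB _ _ (bab0 x)).
by case: (primeB _ _ ba0).
Qed.

(** A group is not the union of two proper subgroups. *)
Lemma union_of_subgroups (V : zmodType) (P Q : V -> Prop) :
  (forall x y, P (x + y) -> P y -> P x) ->
  (forall x y, Q (x + y) -> Q y -> Q x) ->
  (forall x, P x \/ Q x) -> (forall x, P x) \/ (forall x, Q x).
Proof.
move=> subP subQ PQ.
have [|/existsNP[x nPx]] := pselect (forall x, P x); first by left.
have Qx : Q x by case: (PQ x).
right=> y; have [Py|//] := PQ y; apply: (subQ y x) => //.
have [Pxy|//] := PQ (y + x).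
by case: nPx; apply: (subP x y); rewrite // addrC.
Qed.

Variables (A B : nzRingType) (phi : A -> B).
Hypotheses (primeB : prime_ring B) (tfB : forall x : B, x + x = 0 -> x = 0).
Hypotheses (phi_bij : bijective phi) (phiD : {morph phi : x y / x + y}).
Hypothesis phiJ : forall a c, phi (a * c + c * a) = phi a * phi c + phi c * phi a.

Lemma double_inj (x y : B) : x + x = y + y -> x = y.
Proof.
move=> h; apply: subr0_eq; apply: tfB.
by rewrite addrACA h -opprD subrr.
Qed.

Lemma jordan_sqr a : phi (a * a) = phi a * phi a.
Proof. by apply: double_inj; rewrite -phiD phiJ. Qed.

(** With [a o x = a * x + x * a], one has
[a o (a o x) = (a * a) o x + 2 a * x * a]. *)
Lemma jordan_sandwich a x : phi (a * x * a) = phi a * phi x * phi a.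
Proof.
apply: double_inj; apply: (addrI (phi (a * a * x + x * (a * a)))).
rewrite -!phiD.
have -> : a * a * x + x * (a * a) + (a * x * a + a * x * a) =
          a * (a * x + x * a) + (a * x + x * a) * a.
  by rewrite !mulrDl !mulrDr !mulrA [LHS]addrACA [x * a * a + _]addrC.
rewrite !phiJ jordan_sqr !mulrDl !mulrDr !mulrA.
by rewrite [RHS]addrACA; congr (_ + _); rewrite addrC.
Qed.

Lemma jordan_triple a x c :
  phi (a * x * c + c * x * a) = phi a * phi x * phi c + phi c * phi x * phi a.
Proof.
have := jordan_sandwich (a + c) x.
have E (S : nzRingType) (u v w : S) : (u + v) * w * (u + v) =
  u * w * u + v * w * v + (u * w * v + v * w * u).
  by rewrite !mulrDl !mulrDr [v * w * u + _]addrC addrACA.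
by rewrite phiD !E phiD phiD !jordan_sandwich => /addrI.
Qed.

(** With [d = u - p], the first hypothesis says [q = d + w]; after substituting
[u = d + p] and [q = d + w] in the second one, the terms [p * x * w] and
[w * x * p] cancel. *)
Lemma defect_identity (u w p q x : B) : u + w = p + q ->
  u * x * w + w * x * u = p * x * q + q * x * p ->
  (u - p) * x * (u - q) + (u - q) * x * (u - p) = 0.
Proof.
move=> uw; have uE : u = (u - p) + p by rewrite subrK.
have qE : q = (u - p) + w by rewrite addrAC uw addrAC subrr add0r.
have uqE : u - q = p - w by rewrite qE opprD addrA opprB addrCA subrr addr0.
rewrite uqE {1 2}uE [in X in _ = X -> _]qE; move: (u - p) => d.
rewrite !mulrDl !mulrDr addrACA [RHS]addrACA => /addIr h.
rewrite !(mulrN, mulNr) addrACA -opprD [X in X + _]addrC.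
by rewrite h subrr.
Qed.

(** The element [(a b) x (b a) + (b a) x (a b)] can also be written
[a (b x b) a + b (a x a) b], so its image is known in two ways. *)
Lemma jordan_defects a b :
  phi (a * b) = phi a * phi b \/ phi (a * b) = phi b * phi a.
Proof.
set u := phi (a * b); set w := phi (b * a).
have uw : u + w = phi a * phi b + phi b * phi a by rewrite -phiD phiJ.
have [|/subr0_eq|/subr0_eq] := @prime_symmetric_annihilator B
  (u - phi a * phi b) (u - phi b * phi a) primeB tfB; [|by left|by right].
move=> y; have [g _ gK] := phi_bij; rewrite -(gK y); move: (g y) => {y} x.
have uxw : u * phi x * w + w * phi x * u =
    phi a * phi b * phi x * (phi b * phi a)
    + phi b * phi a * phi x * (phi a * phi b).
  rewrite -jordan_triple.
  have -> : a * b * x * (b * a) + b * a * x * (a * b) =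
    a * (b * x * b) * a + b * (a * x * a) * b by rewrite !mulrA.
  by rewrite phiD !jordan_sandwich !mulrA.
exact: defect_identity uw uxw.
Qed.

(** The alternative of [jordan_defects] is made uniform first in [b] for each
[a], then in [a]. *)
Theorem jordan_iso_hom_or_antihom :
  (forall a c, phi (a * c) = phi a * phi c) \/
  (forall a c, phi (a * c) = phi c * phi a).
Proof.
apply: union_of_subgroups.
- move=> a b h hb c; apply: (addIr (phi (b * c))).
  by rewrite {2}hb -phiD -!mulrDl -phiD h.
- move=> a b h hb c; apply: (addIr (phi (b * c))).
  by rewrite {2}hb -phiD -mulrDl -mulrDr -phiD h.
move=> a; apply: union_of_subgroups (jordan_defects a).
- move=> b c h hc; apply: (addIr (phi (a * c))).
  by rewrite {2}hc -phiD -!mulrDr -phiD h.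
- move=> b c h hc; apply: (addIr (phi (a * c))).
  by rewrite {2}hc -phiD -mulrDl -mulrDr -phiD h.
Qed.

End Herstein.

(** * Maps preserving the mixed product *)

Section StarAlgebras.
Set Implicit Arguments. Unset Strict Implicit.
Variable R : realType.

Lemma star1 (A : starAlgType R) : star (1 : A) = 1.
Proof. by rewrite -[LHS]mulr1 -{2}(starK (1 : A)) -starM mulr1 starK. Qed.

Lemma star_bsquare (A : starAlgType R) (eta : R[i]) (a b : A) :
  star (bsquare eta b a) = bsquare (Num.conj eta) a b.
Proof. by rewrite /bsquare starD starZ !starM starK. Qed.

(** The outer [bsquare nu] stars its left factor, which exchanges the two inner
arguments and conjugates [eta]. *)
Lemma preserves_triple_mixed (A B : starAlgType R) (eta nu : R[i]) (Phi : A -> B) :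
  preserves_triple eta nu Phi -> preserves_mixed (Num.conj eta) nu Phi.
Proof.
move=> h a b c; have := h b a c.
have E (C : starAlgType R) (x y z : C) : bsquare nu (bsquare eta x y) z
  = circ nu (bsquare (Num.conj eta) y x) z by rewrite -star_bsquare.
by rewrite !E.
Qed.

Lemma bsquareDr (A : starAlgType R) (eta : R[i]) (a b c : A) :
  bsquare eta a (b + c) = bsquare eta a b + bsquare eta a c.
Proof. by rewrite /bsquare mulrDr mulrDl scalerDr addrACA. Qed.

Lemma circDl (A : starAlgType R) (nu : R[i]) (a b c : A) :
  circ nu (a + b) c = circ nu a c + circ nu b c.
Proof. by rewrite /circ mulrDr mulrDl scalerDr addrACA. Qed.

Lemma bsquare1l (A : starAlgType R) (eta : R[i]) (b : A) :
  bsquare eta 1 b = (1 + eta) *: b.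
Proof. by rewrite /bsquare star1 mul1r mulr1 scalerDl scale1r. Qed.

Lemma bsquare1r (A : starAlgType R) (eta : R[i]) (a : A) :
  bsquare eta a 1 = (1 + eta) *: star a.
Proof. by rewrite /bsquare mul1r mulr1 scalerDl scale1r. Qed.

Lemma circ1r (A : starAlgType R) (nu : R[i]) (a : A) : circ nu a 1 = (1 + nu) *: a.
Proof. by rewrite /circ mul1r mulr1 scalerDl scale1r. Qed.

Lemma circ_symmetrized (A : starAlgType R) (k nu : R[i]) (a c : A) :
  circ nu (k *: a) c + circ nu (k *: c) a = ((1 + nu) * k) *: (a * c + c * a).
Proof.
rewrite /circ -!scalerAl -!scalerAr.
rewrite !scalerA mulrDl mul1r scalerDl !scalerDr addrACA.
by rewrite [_ *: (c * a) + (nu * k) *: _]addrC.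
Qed.

Variables (A B : starAlgType R) (eta nu : R[i]) (Phi : A -> B).
Hypotheses (eta1 : 1 + eta != 0) (nu1 : 1 + nu != 0).
Hypotheses (Phi_bij : bijective Phi) (Phi_mixed : preserves_mixed eta nu Phi).

(** With [a = 1] the mixed product of [t] with [(1 + eta)^-1 *: c] is
[t * c + nu *: (c * t)]. *)
Lemma mixed_sum_of_circ (t x y c : A) : sum_of Phi t x y ->
  sum_of Phi (t * c + nu *: (c * t)) (x * c + nu *: (c * x)) (y * c + nu *: (c * y)).
Proof.
have PhiE z : Phi (z * c + nu *: (c * z)) =
    circ nu (bsquare eta (Phi 1) (Phi z)) (Phi ((1 + eta)^-1 *: c)).
  rewrite -Phi_mixed bsquare1l /circ -!(scalerAl, scalerAr) !scalerA.
  by rewrite divfK // mulfV // scale1r.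
by rewrite /sum_of !PhiE => ->; rewrite bsquareDr circDl.
Qed.

Let kappa_neq0 : (1 + nu) * (1 + eta) != 0. Proof. by rewrite mulf_neq0. Qed.

(** The map [b |-> circ nu (bsquare eta 1 b) 1] is injective on [A], while its
counterpart on [B], with [1] replaced by [Phi 1], kills [1 - Phi 1]. *)
Lemma mixed_unit_projection : Phi 0 = 0 -> is_projection (Phi 1) -> Phi 1 = 1.
Proof.
move=> Phi00 [qS qq]; have [g _ gK] := Phi_bij.
have : (1 + nu) *: ((1 + eta) *: g (1 - Phi 1)) = 0.
  rewrite -(bsquare1l eta) -(circ1r nu); apply: (bij_inj Phi_bij).
  rewrite Phi_mixed gK Phi00 /circ /bsquare -qS mulrBl mulrBr mul1r mulr1 -qq.
  by rewrite subrr scaler0 addr0 mul0r mulr0 scaler0 addr0.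
rewrite scalerA => /eqP; rewrite scaler_eq0 (negbTE kappa_neq0) => /eqP g0.
by apply/esym/subr0_eq; rewrite -[LHS]gK g0.
Qed.

Hypotheses (PhiD : additive_map Phi) (Phi1 : Phi 1 = 1).

Lemma mixed_scale (x : A) :
  Phi (((1 + nu) * (1 + eta)) *: x) = ((1 + nu) * (1 + eta)) *: Phi x.
Proof.
by have := Phi_mixed 1 x 1; rewrite Phi1 !circ1r !bsquare1l !scalerA.
Qed.

Lemma mixed_star : preserves_star Phi.
Proof.
move=> a; apply: (scalerI kappa_neq0); rewrite -mixed_scale.
by have := Phi_mixed a 1 1; rewrite Phi1 !circ1r !bsquare1r !scalerA.
Qed.

(** Exchanging [a] and [c] in [circ nu (bsquare eta 1 a) c] and adding restores
the symmetry that [nu] breaks. *)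
Lemma mixed_jordan (a c : A) : Phi (a * c + c * a) = Phi a * Phi c + Phi c * Phi a.
Proof.
apply: (scalerI kappa_neq0); rewrite -mixed_scale -!circ_symmetrized PhiD.
by rewrite -!bsquare1l !Phi_mixed Phi1.
Qed.

End StarAlgebras.

Lemma scalar_torsion_free (R : realType) (B : starAlgType R) (x : B) :
  x + x = 0 -> x = 0.
Proof.
by move=> /eqP; rewrite -mulr2n -scaler_nat scaler_eq0 pnatr_eq0 => /eqP.
Qed.

Theorem corollary2p1 (R : realType) (A B : starAlgType R)
  (primeA : prime_algebra A)
  (projA : exists p : A, nontrivial_projection p)
  (eta nu : R[i]) (eta_neq0 : eta <> 0) (nu_neq0 : nu <> 0)
  (Phi : A -> B) (Phi_bij : bijective Phi)
  (hyp : [/\ Num.conj eta <> -1, nu <> -1 & preserves_triple eta nu Phi]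
      \/ [/\ eta <> -1, nu <> -1 & preserves_mixed eta nu Phi]) :
  [/\ additive_map Phi,
      is_projection (Phi 1) -> star_jordan_ring_iso Phi
    & prime_algebra B -> is_projection (Phi 1) ->
        star_ring_iso Phi \/ star_ring_anti_iso Phi].
Proof.
have [mu [mu1 nu1 Phi_mixed]] : exists mu : R[i],
    [/\ mu <> -1, nu <> -1 & preserves_mixed mu nu Phi].
  case: hyp => [[e1 n1 h]|[e1 n1 h]]; last by exists eta.
  by exists (Num.conj eta); split => //; exact: preserves_triple_mixed.
have unit_add (z : R[i]) : z <> -1 -> 1 + z != 0.
  by move=> /eqP; rewrite addrC addr_eq0.
have {}mu1 := unit_add _ mu1; have {}nu1 := unit_add _ nu1.
have {}nu_neq0 : nu != 0 by apply/eqP.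
have [p [[_ pp] p0 p1]] := projA.
have pcompl : complementary p (1 - p).
  split; first by rewrite addrC subrK.
    by rewrite mulrBr mulr1 -pp subrr.
  by rewrite mulrBl mul1r -pp subrr.
have np0 : 1 - p <> 0 by move/subr0_eq/esym.
have circP := mixed_sum_of_circ mu1 Phi_mixed.
have PhiD : additive_map Phi.
  by move=> x y; apply: (sum_ofD nu_neq0 nu1 primeA Phi_bij _ x y pcompl p0 np0).
have Phi1 := mixed_unit_projection mu1 nu1 Phi_bij Phi_mixed (Phi0 Phi_bij circP).
have jordan q := mixed_jordan mu1 nu1 Phi_mixed PhiD (Phi1 q).
have starP q := mixed_star mu1 nu1 Phi_mixed (Phi1 q).
split=> // [q|primeB q]; first by split=> //; [exact: jordan|exact: starP].
have [hom|anti] := jordan_iso_hom_or_antihom primeB (@scalar_torsion_free R B)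
  Phi_bij PhiD (jordan q).
- by left; split=> //; exact: starP.
- by right; split=> //; exact: starP.
Qed.
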